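(* Let $\mathcal{L},\mathcal{L}'\subseteq\mathbb{S}^n$ be Jordan spaces of the same dimension $m$. If $\mathcal{L}$ degenerates to $\mathcal{L}'$, then $d(\mathcal{L})\geq d(\mathcal{L}')$, with equality if and only if $\mathcal{L}$ and $\mathcal{L}'$ are congruent.
   Context: $\mathbb{S}^n$ is the space of complex symmetric $n\times n$ matrices. A Jordan space $\mathcal{L}\subseteq\mathbb{S}^n$ is a linear subspace containing an invertible matrix $U$ and closed under $X\bullet_UY=\frac12(XU^{-1}Y+YU^{-1}X)$. The group $\mathrm{GL}_n(\mathbb{C})$ acts on subspaces by congruence, $g\cdot\mathcal{L}=g\mathcal{L}g^\top$; two subspaces are congruent if they lie in the same orbit. Degeneration of Jordan spaces: if $\mathcal{L},\mathcal{L}'\subseteq\mathbb{S}^n$ are Jordan spaces of dimension $m$ with bases $X_1,\dots,X_m$ and $X_1',\dots,X_m'$, then $\mathcal{L}$ degenerates to $\mathcal{L}'$ if there exist $P\in\mathrm{GL}_n(\mathbb{C}[t^{\pm1}])$ and $Q\in\mathrm{GL}_m(\mathbb{C}[t^{\pm1}])$ such that the entries of $(Y_1,\dots,Y_m):=(PX_1P^\top,\dots,PX_mP^\top)Q$ are matrices with coefficients in $\mathbb{C}[t]$ and $X_i'=\lim_{t\to0}Y_i$ for all $i$. Equivalently, $(X_1',\dots,X_m')$ lies in the closure of $\{(Y_1,\dots,Y_m)\in(\mathbb{S}^n)^m\mid\operatorname{span}(Y_1,\dots,Y_m)\in\mathrm{GL}_n(\mathbb{C})\cdot\mathcal{L}\}$.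 The orbit dimension $d(\mathcal{L})$ is the dimension of the irreducible variety $\overline{\{(Y_1,\dots,Y_m)\in(\mathbb{S}^n)^m\mid\operatorname{span}(Y_1,\dots,Y_m)\in\mathrm{GL}_n(\mathbb{C})\cdot\mathcal{L}\}}$. *)

(* Defs.v *)
(* The complex numbers are R[i] for R : realType. *)
From mathcomp Require Import all_boot all_order all_algebra.
From mathcomp Require Import complex.
(* mpoly has to be imported before ereal: their notations clash otherwise. *)
From mathcomp Require Import mpoly.
From mathcomp Require Import boolp classical_sets reals ereal.

Set Implicit Arguments.
Unset Strict Implicit.
Unset Printing Implicit Defensive.

Import Order.TTheory GRing.Theory Num.Theory.

Local Open Scope classical_set_scope.
Local Open Scope ring_scope.

Definition jordan_space (R : realType) (n : nat) (L : {vspace 'M[R[i]]_n}) : Prop :=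
  (forall X, X \in L -> X^T = X) /\
  exists U : 'M[R[i]]_n,
    [/\ U \in L, U \in unitmx &
        forall X Y, X \in L -> Y \in L ->
          2%:R^-1 *: (X *m invmx U *m Y + Y *m invmx U *m X) \in L].

(* The subspace g L g^T. *)
Definition congr_act (R : realType) (n : nat) (g : 'M[R[i]]_n)
    (L : {vspace 'M[R[i]]_n}) : {vspace 'M[R[i]]_n} :=
  (linfun (mulmxr g^T \o mulmx g) @: L)%VS.

Definition congruent (R : realType) (n : nat) (L L' : {vspace 'M[R[i]]_n}) : Prop :=
  exists2 g : 'M[R[i]]_n, g \in unitmx & L' = congr_act g L.

(* C[t, t^-1] inside the field of fractions of C[t]. *)
Definition laurent (R : realType) (f : {fraction {poly R[i]}}) : Prop :=
  exists (p : {poly R[i]}) (k : nat), f = tofrac p / tofrac 'X^k.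

Definition GL_laurent (R : realType) (k : nat)
    (P : 'M[{fraction {poly R[i]}}]_k) : Prop :=
  [/\ P \in unitmx, forall i j, laurent (P i j) &
      forall i j, laurent (invmx P i j)].

Definition const_frac (R : realType) (c : R[i]) : {fraction {poly R[i]}} :=
  tofrac c%:P.

(* Z i is the matrix over C[t] whose image over C(t) is the i-th entry of
   (P X_1 P^T, ..., P X_m P^T) Q; its limit for t -> 0 is its value at 0. *)
Definition bases_degenerate (R : realType) (n m : nat)
    (X X' : m.-tuple 'M[R[i]]_n) : Prop :=
  exists (P : 'M[{fraction {poly R[i]}}]_n) (Q : 'M[{fraction {poly R[i]}}]_m),
    [/\ GL_laurent P, GL_laurent Q &
      exists Z : 'I_m -> 'M[{poly R[i]}]_n,
        forall i : 'I_m,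
          \sum_(j < m) Q j i *: (P *m map_mx (@const_frac R) (tnth X j) *m P^T)
            = map_mx (@tofrac _) (Z i) /\
          tnth X' i = map_mx (fun p : {poly R[i]} => p.[0]) (Z i)].

(* The choice of the bases is immaterial: it is absorbed by Q.  The condition
   basis_of L' X' forces L and L' to have the same dimension. *)
Definition degenerates (R : realType) (n : nat) (L L' : {vspace 'M[R[i]]_n}) : Prop :=
  exists X X' : (\dim L).-tuple 'M[R[i]]_n,
    [/\ basis_of L X, basis_of L' X' & bases_degenerate X X'].

Section ZariskiTopology.

Variables (R : realType) (N : nat).

Implicit Types A B Z : set 'rV[R[i]]_N.

Definition zariski_closed Z : Prop :=
  exists S : set {mpoly R[i][N]},
    Z = [set x : 'rV[R[i]]_N | forall p, S p -> p.@[x ord0] = 0].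

Definition zariski_closure A : set 'rV[R[i]]_N :=
  \bigcap_(Z in [set Z | zariski_closed Z /\ A `<=` Z]) Z.

Definition zariski_irreducible Z : Prop :=
  Z !=set0 /\
  forall A B, zariski_closed A -> zariski_closed B ->
    Z `<=` A `|` B -> Z `<=` A \/ Z `<=` B.

(* A chain F 0 < F 1 < ... < F k; the values of F beyond k are irrelevant. *)
Definition irreducible_chain Z (k : nat) (F : nat -> set 'rV[R[i]]_N) : Prop :=
  (forall i, (i <= k)%N ->
     [/\ zariski_closed (F i), zariski_irreducible (F i) & F i `<=` Z]) /\
  (forall i, (i < k)%N -> F i `<` F i.+1).

(* Krull dimension of a Zariski closed set; the empty set has dimension -oo. *)
Definition variety_dim Z : \bar R :=
  ereal_sup [set k%:R%:E%E | k in [set k : nat | exists F, irreducible_chain Z k F]].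

End ZariskiTopology.

(* Coordinates on (M_n)^m, in which (S^n)^m is a linear subspace; Zariski closed
   subsets of (S^n)^m are those of (M_n)^m that it contains. *)
Definition tuple_coord (R : realType) (n m : nat) (Y : m.-tuple 'M[R[i]]_n) :
    'rV[R[i]]_(m * (n * n)) :=
  mxvec (\matrix_(i < m) mxvec (tnth Y i)).

Definition orbit_tuples (R : realType) (n : nat) (L : {vspace 'M[R[i]]_n}) :
    set ((\dim L).-tuple 'M[R[i]]_n) :=
  [set Y : (\dim L).-tuple 'M[R[i]]_n |
    (forall i, (tnth Y i)^T = tnth Y i) /\ congruent L <<Y>>%VS].

Definition orbit_dim (R : realType) (n : nat) (L : {vspace 'M[R[i]]_n}) : \bar R :=
  variety_dim (zariski_closure (@tuple_coord R n (\dim L) @` @orbit_tuples R n L)).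

(* Main.v *)
Require Import Defs.
From mathcomp Require Import all_boot all_order all_algebra.
From mathcomp Require Import closed_field complex.
From mathcomp Require Import mpoly.
From mathcomp Require Import zify ring.
From mathcomp Require Import boolp classical_sets reals constructive_ereal ereal.

(** The tuples spanning a subspace congruent to L form one orbit O(L) of
    GL_n x GL_m acting on m-tuples of matrices by X |-> (g X g^T) h, and d(L) is
    the dimension of its Zariski closure C(L).  The statement is the usual
    comparison of an orbit with an orbit in its closure.

    A degeneration is a polynomial curve that lies in O(L) for almost all t and
    passes at t = 0 through a basis of L'.  A polynomial vanishing on O(L)
    restricts to a univariate polynomial with infinitely many zeros, hence it
    vanishes at t = 0 too; moving the curve by the group gives C(L') <= C(L)
    (degenerate_orbit_variety), and the inequality of dimensions follows.

    If C(L') is a proper subset of C(L), the dimensions differ, provided that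
    C(L) is irreducible and that dimensions are finite (variety_dim_proper).
    Irreducibility holds because two points of O(L) are joined by the image of a
    line in the space of pairs (g, h), whose generic point is invertible.
    Finiteness is the bound of the Krull dimension of affine N-space by N.  Let
    h_Z(d) be the number of linearly independent functions on Z given by
    polynomials of degree at most d.  If f vanishes on Z1 but not on the larger
    irreducible set Z2, multiplication by f is injective on functions on Z2 and
    its image restricts to 0 on Z1, so h_Z2(d) >= h_Z1(d) + h_Z2(d - deg f).
    Pascal's rule turns this into growth of order d^k along a chain of length k,
    whereas h is at most (d + 1)^N.

    If C(L) = C(L'), both orbits contain a nonempty open part of the same
    irreducible set, so they meet and L is congruent to L'.  That O(L) contains
    an open part of its closure is Chevalley's theorem; it is obtained from
    quantifier elimination over algebraically closed fields, because a
    quantifier-free formula has a constant truth value on a nonempty open part of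
    any irreducible set (qf_generic_truth).  *)

Set Implicit Arguments.
Unset Strict Implicit.
Unset Printing Implicit Defensive.

Import Order.TTheory GRing.Theory Num.Theory.

Local Open Scope classical_set_scope.
Local Open Scope ring_scope.

(** * Vanishing of polynomials and irreducible sets *)

Section ZariskiBasics.
Variables (R : realType) (N : nat).
Implicit Types (A Z : set 'rV[R[i]]_N) (p q : {mpoly R[i][N]}).

Definition vanishes_on A p := forall x, A x -> p.@[x ord0] = 0.

Lemma zariski_closureP A x :
  zariski_closure A x <-> forall p, vanishes_on A p -> p.@[x ord0] = 0.
Proof.
split=> [Ax p Ap|Ax Z [[S ->] AS] p Sp]; last by apply: Ax => y /AS; apply.
apply: (Ax [set y | forall q, [set p] q -> q.@[y ord0] = 0]); last by [].
by split; [exists [set p] | move=> y Ay q ->; exact: Ap].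
Qed.

Lemma subset_zariski_closure A : A `<=` zariski_closure A.
Proof. by move=> x Ax; apply/zariski_closureP => p; apply. Qed.

Lemma zariski_closure_closed A : zariski_closed (zariski_closure A).
Proof.
exists (vanishes_on A); apply/seteqP; split=> x /=.
  by move=> /zariski_closureP.
by move=> h; apply/zariski_closureP.
Qed.

Lemma zariski_closure_min A Z :
  zariski_closed Z -> A `<=` Z -> zariski_closure A `<=` Z.
Proof. by move=> cZ AZ x; apply. Qed.

Lemma zariski_closed_separate Z x : zariski_closed Z -> ~ Z x ->
  exists2 p, vanishes_on Z p & p.@[x ord0] != 0.
Proof.
move=> [S ->] /existsNP[p /not_implyP[Sp px]]; exists p; last exact/eqP.
by move=> y; apply.
Qed.

Lemma zero_set_closed p : zariski_closed [set x | p.@[x ord0] = 0].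
Proof.
exists [set p]; apply/seteqP; split=> x /=; first by move=> ? ? ->.
exact.
Qed.

Lemma vanishes_onPn Z p :
  ~ vanishes_on Z p <-> exists2 x, Z x & p.@[x ord0] != 0.
Proof.
split=> [/existsNP[x /not_implyP[Zx /eqP px]]|[x Zx px] Zp]; first by exists x.
by rewrite Zp ?eqxx in px.
Qed.

Lemma irreducible_vanishes_onM Z p q : zariski_irreducible Z ->
  vanishes_on Z (p * q) -> vanishes_on Z p \/ vanishes_on Z q.
Proof.
move=> [_ irrZ] Zpq; apply: (irrZ _ _ (zero_set_closed p) (zero_set_closed q)).
move=> x /Zpq; rewrite mevalM => /eqP; rewrite mulf_eq0.
by move=> /orP[] /eqP; [left|right].
Qed.

End ZariskiBasics.

(** * Krull dimension of affine space *)

Section KrullDimension.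
Variables (R : realType) (N : nat).
Implicit Types (A Z : set 'rV[R[i]]_N) (p q : {mpoly R[i][N]}).

(** A lower bound r for the Hilbert function of Z in degree d, stated with a
    family of polynomials so that no quotient by the ideal of Z is needed. *)
Definition hilbert_ge Z (d r : nat) :=
  exists2 s : 'I_r -> {mpoly R[i][N]}, (forall i, (msize (s i) <= d.+1)%N) &
    forall c : 'I_r -> R[i],
      vanishes_on Z (\sum_i c i *: s i) -> forall i, c i = 0.

Lemma hilbert_ge1 Z d : Z !=set0 -> hilbert_ge Z d 1.
Proof.
move=> [x Zx]; exists (fun _ => 1) => [i|c]; first by rewrite msize1.
move=> /(_ x Zx); rewrite big_ord1 mevalZ meval1 mulr1 => c0 i.
by rewrite ord1.
Qed.

(** An r1-family for Z1 together with f times an r2-family for Z2 is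
    independent on Z2: restricting a relation to Z1 kills the multiples of f and
    so the first coefficients, and then f cancels because Z2 is irreducible. *)
Lemma hilbert_geD Z1 Z2 f d1 d2 e r1 r2 :
  Z1 `<=` Z2 -> zariski_irreducible Z2 ->
  vanishes_on Z1 f -> ~ vanishes_on Z2 f ->
  (msize f <= e.+1)%N -> (d2 + e <= d1)%N ->
  hilbert_ge Z1 d1 r1 -> hilbert_ge Z2 d2 r2 -> hilbert_ge Z2 d1 (r1 + r2).
Proof.
move=> Z12 irrZ2 f1 f2 fe de [s1 s1d s1P] [s2 s2d s2P].
exists (fun i => match split i with inl a => s1 a | inr b => f * s2 b end).
  move=> i; case: (split i) => a.
    exact: s1d.
  have [->|nf] := eqVneq f 0; first by rewrite mul0r msize0.
  have [->|ns] := eqVneq (s2 a) 0; first by rewrite mulr0 msize0.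
  rewrite msizeM //; move: (s2d a) fe de.
  by move: (msize (s2 a)) (msize f) => u v; lia.
move=> c; rewrite big_split_ord /=.
under eq_bigr do rewrite (unsplitK (inl _)).
under [X in _ + X]eq_bigr do rewrite (unsplitK (inr _)) scalerAr.
rewrite -mulr_sumr => c0.
have cl : forall a, c (lshift r2 a) = 0.
  apply: s1P => x Z1x; have := c0 x (Z12 _ Z1x).
  by rewrite mevalD mevalM f1 // mul0r addr0.
have cr : forall b, c (rshift r1 b) = 0.
  apply: s2P; move: c0; rewrite big1 ?add0r; last by move=> a _; rewrite cl scale0r.
  by move=> /(irreducible_vanishes_onM irrZ2)[].
by move=> i; rewrite -(splitK i); case: (split i).
Qed.

(** Polynomials of degree at most d are combinations of the (d + 1)^N monomials
    with all exponents at most d; this count is easier than the exact dimension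
    and has the same order of growth. *)
Lemma hilbert_ge_bound Z d r : hilbert_ge Z d r -> (r <= d.+1 ^ N)%N.
Proof.
move=> [s sd sP]; rewrite leqNgt; apply/negP => rbig.
pose T := {ffun 'I_N -> 'I_d.+1}.
have cT : #|T| = (d.+1 ^ N)%N by rewrite card_ffun !card_ord.
pose mon (t : T) : 'X_{1..N} := [multinom nat_of_ord (t i) | i < N].
pose A : 'M[R[i]]_(r, #|T|) := \matrix_(i, j) (s i)@_(mon (enum_val j)).
(* More rows than columns: a row of the kernel is a relation among the s i. *)
have : kermx A != 0.
  rewrite -mxrank_eq0 mxrank_ker subn_eq0 -ltnNge.
  by apply: leq_ltn_trans (rank_leq_col A) _; rewrite cT.
move=> /eqP; apply; apply/row_matrixP => k; rewrite row0.
have /(congr1 (row k)) := mulmx_ker A; rewrite row_mul row0.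
set u := row k _ => uA; apply/rowP => i; rewrite [RHS]mxE.
apply: (sP (u 0)) => x _; suff -> : \sum_i u 0 i *: s i = 0 by rewrite meval0.
apply/mpolyP => m; rewrite mcoeff0 raddf_sum /=.
have [mT|/existsNP[l /negP ml]] := pselect (forall l, (m l < d.+1)%N).
  pose t : T := [ffun l => Ordinal (mT l)].
  have mt : mon t = m by apply/mnmP => l; rewrite mnmE ffunE.
  move/rowP/(_ (enum_rank t)): uA; rewrite !mxE => uA; rewrite -[RHS]uA.
  by apply: eq_bigr => j _; rewrite mcoeffZ [A _ _]mxE enum_rankK mt.
rewrite big1 // => j _; rewrite mcoeffZ memN_msupp_eq0 ?mulr0 //.
apply: msize_mdeg_ge; apply: leq_trans (sd j) _.
rewrite -leqNgt in ml; apply: leq_trans ml _.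
by rewrite mdegE (bigD1 l) //= leq_addr.
Qed.

Lemma irreducible_chain_separate Z k F : irreducible_chain Z k F ->
  exists e (f : nat -> {mpoly R[i][N]}), forall i, (i < k)%N ->
    [/\ vanishes_on (F i) (f i), ~ vanishes_on (F i.+1) (f i) &
        (msize (f i) <= e.+1)%N].
Proof.
move=> [Fcl Flt].
have sep i : exists p, (i < k)%N -> vanishes_on (F i) p /\ ~ vanishes_on (F i.+1) p.
  have [ik|] := boolP (i < k)%N; last by exists 0.
  have [_ /existsNP[x /not_implyP[Fx Fx']]] := Flt i ik.
  have [Fc _ _] := Fcl i (ltnW ik).
  have [p pF px] := zariski_closed_separate Fc Fx'; exists p => _.
  by split=> //; apply/vanishes_onPn; exists x.
have [f fP] := choice sep.
exists (\max_(i < k) msize (f i)), f => i ik; have [f1 f2] := fP i ik.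
split=> //; apply: leqW.
exact: (leq_bigmax (Ordinal ik)).
Qed.

(** The inequality of hilbert_geD is Pascal's rule when the degrees run through
    the multiples of a common bound e for the degrees of the separating
    polynomials, so the Hilbert function of F k grows like a binomial. *)
Lemma hilbert_ge_chain Z k F : irreducible_chain Z k F ->
  exists e, forall j, hilbert_ge (F k) (e * j) 'C(k + j, k).
Proof.
move=> chF; have [e [f fP]] := irreducible_chain_separate chF; case: chF => Fcl Flt.
exists e; suff H i : (i <= k)%N -> forall j, hilbert_ge (F i) (e * j) 'C(i + j, i).
  exact: H.
elim: i => [_ j|i IHi ik].
  by rewrite bin0; apply: hilbert_ge1; have [_ [? _] _] := Fcl 0 (leq0n k).
have [_ irrF _] := Fcl _ ik.
elim=> [|j IHj]; first by rewrite addn0 binn; apply: hilbert_ge1; case: irrF.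
rewrite addSn binS addnC -[(i + j.+1)%N in X in (_ + X)%N]addSnnS.
have [f1 f2 fe] := fP i ik.
apply: (hilbert_geD _ irrF f1 f2 fe) IHj; last by apply: IHi; exact: ltnW.
  by have [] := Flt i ik.
by rewrite mulnS addnC.
Qed.

(** For k = N + 1 the lower bound 'C(N + 1 + j, N + 1) has degree N + 1 in j,
    while the upper bound (e j + 1)^N has degree N. *)
Lemma irreducible_chain_le Z k F : irreducible_chain Z k F -> (k <= N)%N.
Proof.
move=> [Fcl Flt]; rewrite leqNgt; apply/negP => Nk.
have ch : irreducible_chain Z N.+1 F.
  by split=> i iN; [apply: Fcl | apply: Flt]; apply: leq_trans iN Nk.
have [e H] := hilbert_ge_chain ch.
(* Large enough for j * (j + 1)^N to dominate (N + 1)! * (e * j + 1)^N. *)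
pose j := ((N.+1)`! * e.+1 ^ N)%N.
have := hilbert_ge_bound (H j).
rewrite leqNgt => /negP; apply.
rewrite -(ltn_pmul2r (fact_gt0 N.+1)) bin_ffact.
have expn_mono a b l : (a <= b)%N -> (a ^ l <= b ^ l)%N.
  by move=> ab; elim: l => // l IHl; rewrite !expnS leq_mul.
have e1 : (((e * j).+1 ^ N * (N.+1)`!) <= (j * j.+1 ^ N))%N.
  rewrite [leqRHS](_ : _ = ((N.+1)`! * (e.+1 * j.+1) ^ N)%N).
    by rewrite mulnC leq_mul2l expn_mono ?orbT //; move: j; nia.
  by rewrite expnMn mulnA.
apply: leq_ltn_trans e1 _.
apply: (@leq_trans (j.+1 ^ N.+1)); first by rewrite expnS ltn_pmul2r ?expn_gt0.
have L a b : (a.+1 ^ b <= (b + a) ^_ b)%N.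
  elim: b => [|b IHb] //; rewrite expnS addSn ffactSS.
  by rewrite leq_mul // ltnS leq_addl.
exact: L.
Qed.

Lemma variety_dim_subset Z1 Z2 : Z1 `<=` Z2 ->
  (variety_dim Z1 <= variety_dim Z2)%E.
Proof.
move=> Z12; apply: le_ereal_sup => _ [k [F [F1 F2]] <-]; exists k => //.
exists F; split=> // i ik; have [? ? FZ] := F1 i ik; split=> //.
exact: subset_trans FZ Z12.
Qed.

(** Since chains have length at most N, the supremum is a maximum. *)
Lemma variety_dim_attained Z : zariski_closed Z -> zariski_irreducible Z ->
  exists2 k, exists F, irreducible_chain Z k F & variety_dim Z = k%:R%:E%E.
Proof.
move=> cZ iZ; pose P k := `[< exists F, irreducible_chain Z k F >].
have P0 : exists k, P k.
  by exists 0; apply/asboolP; exists (fun _ => Z); split=> // i _; split.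
have PN k : P k -> (k <= N)%N by move=> /asboolP[F /irreducible_chain_le].
case: (ex_maxnP P0 PN) => k /asboolP Pk kmax; exists k => //.
apply/eqP; rewrite eq_le; apply/andP; split.
  apply: ge_ereal_sup => _ [l /asboolP Pl <-]; rewrite lee_fin ler_nat.
  exact: kmax.
by apply: ereal_sup_ubound; exists k.
Qed.

(** A longest chain of Z1 is extended by Z2 itself. *)
Lemma variety_dim_proper Z1 Z2 :
  zariski_closed Z1 -> zariski_irreducible Z1 ->
  zariski_closed Z2 -> zariski_irreducible Z2 ->
  Z1 `<` Z2 -> (variety_dim Z1 < variety_dim Z2)%E.
Proof.
move=> c1 i1 c2 i2 [Z12 nZ21].
have [k [F [F1 F2]] ->] := variety_dim_attained c1 i1.
apply: (@lt_le_trans _ _ (k.+1)%:R%:E%E); first by rewrite lte_fin ltr_nat.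
apply: ereal_sup_ubound; exists k.+1 => //.
exists (fun i => if (i <= k)%N then F i else Z2); split=> i ik /=.
  case: ifP => [ik'|_]; last by split.
  have [? ? FZ] := F1 i ik'; split=> //.
  exact: subset_trans FZ Z12.
rewrite -ltnS ik; case: ltnP => [|ki]; first exact: F2.
have [_ _ FZ] := F1 i ik.
split; first exact: subset_trans FZ Z12.
by move=> ZF; apply: nZ21; apply: subset_trans ZF FZ.
Qed.

End KrullDimension.

(** * The orbit of GL_n x GL_m on tuples of matrices *)

Section FrameAction.
Variables (S : comNzRingType) (n m : nat).

(** The second factor acts on the right, as the matrix Q does in a degeneration.
    The base ring is arbitrary: the action is used over the field, over its
    polynomial ring and over the fraction field of the latter. *)
Definition frame_act (g : 'M[S]_n) (h : 'M[S]_m) (X : m.-tuple 'M[S]_n) :=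
  [tuple \sum_j h j i *: (g *m tnth X j *m g^T) | i < m].

Definition map_frame (T : comNzRingType) (f : S -> T) (X : m.-tuple 'M[S]_n) :=
  [tuple of map (map_mx f) X].

Lemma frame_actZ g h X a b i :
  tnth (frame_act (a *: g) (b *: h) X) i = (a ^+ 2 * b) *: tnth (frame_act g h X) i.
Proof.
rewrite !tnth_mktuple scaler_sumr; apply: eq_bigr => j _.
by rewrite mxE linearZ /= -!scalemxAl -scalemxAr !scalerA; congr (_ *: _); ring.
Qed.

End FrameAction.

Lemma map_frame_act (S T : comNzRingType) (n m : nat) (f : {rmorphism S -> T})
    g h (X : m.-tuple 'M[S]_n) :
  map_frame f (frame_act g h X)
  = frame_act (map_mx f g) (map_mx f h) (map_frame f X).
Proof.
apply: eq_from_tnth => i; rewrite tnth_map !tnth_mktuple raddf_sum.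
apply: eq_bigr => j _ /=.
by rewrite map_mxZ !map_mxM map_trmx tnth_map mxE.
Qed.

Lemma basis_change (F : fieldType) (V : vectType F) (U : {vspace V}) (m : nat)
    (X Y : m.-tuple V) : basis_of U X -> basis_of U Y ->
  exists2 h : 'M[F]_m, h \in unitmx &
    forall i, tnth Y i = \sum_j h j i *: tnth X j.
Proof.
move=> bX bY.
have coordE (A B : m.-tuple V) i : basis_of U A -> basis_of U B ->
    tnth B i = \sum_j coord A j (tnth B i) *: tnth A j.
  move=> bA bB; rewrite [LHS](coord_span (X := A)).
    by apply: eq_bigr => j _; rewrite [tnth A j](tnth_nth 0).
  by rewrite (span_basis bA) (basis_mem bB) ?mem_tnth.
pose h := \matrix_(j, i) coord X j (tnth Y i).
exists h; last first.
  move=> i; rewrite {1}(coordE X Y i bX bY).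
  by apply: eq_bigr => j _; rewrite mxE.
pose k := \matrix_(j, i) coord Y j (tnth X i).
suff /mulmx1_unit[] : h *m k = 1%:M by [].
apply/matrixP => j i; rewrite !mxE.
have fX := basis_free bX.
have -> : (j == i)%:R = coord X j (tnth X i).
  by rewrite (tnth_nth 0) coord_free // eq_sym.
rewrite [in RHS](coordE Y X i bY bX) linear_sum; apply: eq_bigr => l _ /=.
by rewrite linearZ !mxE mulrC.
Qed.

Section Orbits.
Variables (R : realType) (n m : nat).
Implicit Types (L : {vspace 'M[R[i]]_n}) (X Y : m.-tuple 'M[R[i]]_n).

(** The set orbit_tuples with m in place of \dim L, so that the sets of two
    subspaces of the same dimension live in the same type. *)
Definition orbit_frames L : set (m.-tuple 'M[R[i]]_n) :=
  [set Y | (forall i, (tnth Y i)^T = tnth Y i) /\ congruent L <<Y>>%VS].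

Definition orbit_variety L := zariski_closure (@tuple_coord R n m @` orbit_frames L).

Lemma congr_actE (g X : 'M[R[i]]_n) :
  linfun (mulmxr g^T \o mulmx g) X = g *m X *m g^T.
Proof. by rewrite lfunE. Qed.

Lemma congr_act1 L : congr_act 1%:M L = L.
Proof.
rewrite /congr_act -[RHS]lim1g; congr (_ @: _)%VS; apply/lfunP => A.
by rewrite congr_actE trmx1 mulmx1 mul1mx id_lfunE.
Qed.

Lemma congr_actM g h L : congr_act g (congr_act h L) = congr_act (g *m h) L.
Proof.
rewrite /congr_act -limg_comp; congr (_ @: _)%VS; apply/lfunP => A.
by rewrite comp_lfunE !congr_actE trmx_mul !mulmxA.
Qed.

Lemma congruent_sym L L' : congruent L L' -> congruent L' L.
Proof.
move=> [g gu ->]; exists (invmx g); first by rewrite unitmx_inv.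
by rewrite congr_actM mulVmx // congr_act1.
Qed.

Lemma congruent_trans L1 L2 L3 :
  congruent L1 L2 -> congruent L2 L3 -> congruent L1 L3.
Proof.
move=> [g gu ->] [h hu ->]; exists (h *m g); last by rewrite congr_actM.
by rewrite unitmx_mul hu gu.
Qed.

Lemma dim_congr_act g L : g \in unitmx -> \dim (congr_act g L) = \dim L.
Proof.
move=> gu; apply: limg_dim_eq; apply/eqP; rewrite -subv0 capvC.
apply: subv_trans (capvSl _ _) _; apply/subvP => A; rewrite memv_ker memv0.
rewrite congr_actE => /eqP gA; apply/eqP.
have : invmx g *m (g *m A *m g^T) *m invmx g^T = 0 by rewrite gA mulmx0 mul0mx.
by rewrite -trmx_inv mulmxA mulKmx // -mulmxA -trmx_mul mulVmx // trmx1 mulmx1.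
Qed.

Lemma span_frame_act g h X : h \in unitmx ->
  <<frame_act g h X>>%VS = congr_act g <<X>>.
Proof.
move=> hu; rewrite /congr_act limg_span; set gX := map _ _.
have gXE j : g *m tnth X j *m g^T \in gX.
  by rewrite -congr_actE map_f ?mem_tnth.
apply/eqP; rewrite eqEsubv; apply/andP; split; apply/span_subvP => A.
  move=> /tnthP[i ->]; rewrite tnth_mktuple memv_suml // => j _.
  by rewrite memvZ // memv_span.
move=> /mapP[_ /tnthP[i ->] ->]; rewrite congr_actE.
suff -> : g *m tnth X i *m g^T
    = \sum_j invmx h j i *: tnth (frame_act g h X) j.
  by rewrite memv_suml // => j _; rewrite memvZ // memv_span ?mem_tnth.
under eq_bigr do rewrite tnth_mktuple scaler_sumr.
rewrite exchange_big /= (bigD1 i) //= [X in _ + X]big1 ?addr0 => [|j ji].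
  under eq_bigr do rewrite scalerA mulrC.
  have /matrixP/(_ i i) := mulmxV hu; rewrite !mxE eqxx -scaler_suml => ->.
  by rewrite scale1r.
under eq_bigr do rewrite scalerA mulrC.
have /matrixP/(_ j i) := mulmxV hu; rewrite !mxE (negbTE ji) -scaler_suml => ->.
by rewrite scale0r.
Qed.

Lemma frame_act_orbit L g h X : g \in unitmx -> h \in unitmx ->
  orbit_frames L X -> orbit_frames L (frame_act g h X).
Proof.
move=> gu hu [symX LX]; split.
  move=> i; rewrite tnth_mktuple raddf_sum; apply: eq_bigr => j _ /=.
  by rewrite linearZ /= !trmx_mul trmxK symX mulmxA.
by rewrite span_frame_act //; apply: congruent_trans LX _; exists g.
Qed.

(** Two frames of congruent spaces: g carries the span of X to the span of Y,
    and h is the change of basis inside the latter. *)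
Lemma orbit_frames_transitive L X Y : \dim L = m ->
  orbit_frames L X -> orbit_frames L Y ->
  exists g h, [/\ g \in unitmx, h \in unitmx & Y = frame_act g h X].
Proof.
move=> dL [_ LX] [_ LY].
have basis_orbit (Z : m.-tuple _) : congruent L <<Z>> -> basis_of <<Z>> Z.
  by move=> [g gu E]; rewrite basisEdim subvv /= E dim_congr_act // dL size_tuple.
have [g gu E] := congruent_trans (congruent_sym LX) LY.
have bg : basis_of <<Y>> (frame_act g 1%:M X).
  rewrite basisEdim span_frame_act ?unitmx1 // -E subvv size_tuple /=.
  by have [g' gu' ->] := LY; rewrite dim_congr_act // dL.
have [h hu Yh] := basis_change bg (basis_orbit _ LY).
exists g, h; split=> //; apply: eq_from_tnth => i; rewrite Yh tnth_mktuple.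
apply: eq_bigr => j _; congr (_ *: _); rewrite tnth_mktuple (bigD1 j) //=.
rewrite mxE eqxx scale1r big1 ?addr0 // => l lj.
by rewrite mxE (negbTE lj) scale0r.
Qed.

Lemma basis_orbit_frames L X : (forall A, A \in L -> A^T = A) ->
  basis_of L X -> orbit_frames L X.
Proof.
move=> symL bX; split; first by move=> i; rewrite symL // (basis_mem bX) ?mem_tnth.
by exists 1%:M; rewrite ?unitmx1 // congr_act1 (span_basis bX).
Qed.

Lemma congruent_orbit_frames L L' :
  congruent L L' -> orbit_frames L = orbit_frames L'.
Proof.
move=> LL'; apply/seteqP; split=> Y [symY LY]; split=> //.
  exact: congruent_trans (congruent_sym LL') LY.
exact: congruent_trans LL' LY.
Qed.

Lemma tuple_coord_inj : injective (@tuple_coord R n m).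
Proof.
move=> X Y /(can_inj mxvecK)/matrixP XY; apply: eq_from_tnth => i.
by apply: (can_inj mxvecK); apply/rowP => k; have := XY i k; rewrite !mxE.
Qed.

End Orbits.

Arguments orbit_variety {R n} m L.

(** * Polynomial curves *)

Section Curves.
Variables (R : realType).
Implicit Types (r d : {poly R[i]}).

Lemma poly_nonroot r : r != 0 -> exists c, r.[c] != 0.
Proof.
move=> r0; apply: contrapT => /forallNP rN.
pose s := [seq i%:R : R[i] | i <- iota 0 (size r)].
have := max_poly_roots (rs := s) r0; rewrite size_map size_iota ltnn.
move=> H; have : false; last by [].
apply: H; first by apply/allP => c _; apply/rootP/eqP/negPn/negP/rN.
by rewrite map_inj_uniq ?iota_uniq // => a b /eqP; rewrite eqr_nat => /eqP.
Qed.

(** The field is infinite, so a nonzero product d * r would have a nonroot. *)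
Lemma poly_eq0_generic r d : d != 0 -> (forall c, d.[c] != 0 -> r.[c] = 0) ->
  r = 0.
Proof.
move=> d0 H; apply/eqP; apply: contrapT => /negP r0.
have [c] := poly_nonroot (mulf_neq0 d0 r0).
by rewrite hornerM mulf_eq0 negb_or => /andP[/H ->]; rewrite eqxx.
Qed.

Variables (n m : nat).

Lemma meval_curve (p : {mpoly R[i][m * (n * n)]})
    (Z : m.-tuple 'M[{poly R[i]}]_n) :
  exists r, forall c,
    r.[c] = p.@[tuple_coord (map_frame (horner_eval c) Z) ord0].
Proof.
pose W : 'rV[{poly R[i]}]__ := mxvec (\matrix_(i < m) mxvec (tnth Z i)).
exists (\sum_(k <- msupp p) (p@_k)%:P * \prod_i (W 0 i) ^+ k i) => c.
rewrite mevalE horner_sum; apply: eq_bigr => k _.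
rewrite hornerM hornerC horner_prod; congr (_ * _); apply: eq_bigr => i _.
rewrite horner_exp; congr (_ ^+ _); rewrite /W /tuple_coord.
case/mxvec_indexP: i => i l; rewrite !mxvecE !mxE tnth_map.
by case/mxvec_indexP: l => a b; rewrite !mxvecE !mxE.
Qed.

End Curves.

(** * Degenerations and irreducibility of the orbit closure *)

Section Degeneration.
Variables (R : realType) (n m : nat).
Implicit Types (L : {vspace 'M[R[i]]_n}) (X Y : m.-tuple 'M[R[i]]_n).

Lemma map_mx_hornerC k l (A : 'M[R[i]]_(k, l)) c :
  map_mx (horner_eval c) (map_mx polyC A) = A.
Proof. by apply/matrixP => a b; rewrite !mxE /= /horner_eval hornerC. Qed.

Lemma map_frame_hornerC X c : map_frame (horner_eval c) (map_frame polyC X) = X.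
Proof. by apply: eq_from_tnth => i; rewrite !tnth_map map_mx_hornerC. Qed.

(** If polynomials p and q are nonzero at two points of the orbit, then both are
    nonzero at a common point of it: join the two group elements by a line; the
    determinants and the pullbacks of p and q are nonzero polynomials on that
    line, so a common nonroot exists. *)
Lemma orbit_variety_irreducible L X : \dim L = m -> orbit_frames L X ->
  zariski_irreducible (orbit_variety m L).
Proof.
move=> dL OX; split.
  by exists (tuple_coord X); apply: subset_zariski_closure; exists X.
move=> A B cA cB sub.
have [OA|/existsNP[_ /not_implyP[[Y1 OY1 <-] nA]]] :=
    pselect (@tuple_coord R n m @` orbit_frames L `<=` A).
  by left; apply: zariski_closure_min.
have [OB|/existsNP[_ /not_implyP[[Y2 OY2 <-] nB]]] :=
    pselect (@tuple_coord R n m @` orbit_frames L `<=` B).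
  by right; apply: zariski_closure_min.
exfalso.
have [p Ap pY1] := zariski_closed_separate cA nA.
have [q Bq qY2] := zariski_closed_separate cB nB.
have [g1 [h1 [g1u h1u E1]]] := orbit_frames_transitive dL OX OY1.
have [g2 [h2 [g2u h2u E2]]] := orbit_frames_transitive dL OX OY2.
pose line k (a b : 'M[R[i]]_k) : 'M[{poly R[i]}]_k :=
  map_mx polyC a + 'X *: map_mx polyC (b - a).
have lineE k (a b : 'M[R[i]]_k) c :
    map_mx (horner_eval c) (line k a b) = a + c *: (b - a).
  by apply/matrixP => i j; rewrite !mxE /horner_eval !hornerE.
have line0 k (a b : 'M[R[i]]_k) : map_mx (horner_eval 0) (line k a b) = a.
  by rewrite lineE scale0r addr0.
have line1 k (a b : 'M[R[i]]_k) : map_mx (horner_eval 1) (line k a b) = b.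
  by rewrite lineE scale1r addrC subrK.
pose Z := frame_act (line n g1 g2) (line m h1 h2) (map_frame polyC X).
have ZE c : map_frame (horner_eval c) Z
    = frame_act (map_mx (horner_eval c) (line n g1 g2))
                (map_mx (horner_eval c) (line m h1 h2)) X.
  rewrite map_frame_act [map_frame _ _]map_frame_hornerC; exact: erefl.
have [rp rpE] := meval_curve p Z; have [rq rqE] := meval_curve q Z.
have rp0 : rp != 0.
  apply: contraNneq pY1 => rp0.
  by rewrite E1 -[g1](line0 n _ g2) -[h1](line0 m _ h2) -ZE -rpE rp0 horner0.
have rq0 : rq != 0.
  apply: contraNneq qY2 => rq0.
  by rewrite E2 -[g2](line1 n g1) -[h2](line1 m h1) -ZE -rqE rq0 horner0.
have det0 k (a b : 'M[R[i]]_k) : a \in unitmx -> \det (line k a b) != 0.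
  rewrite unitmxE unitfE -{1}(line0 k a b) det_map_mx.
  by apply: contraNneq => ->; rewrite rmorph0.
have [c] := poly_nonroot (mulf_neq0 (mulf_neq0 rp0 rq0)
  (mulf_neq0 (det0 n g1 g2 g1u) (det0 m h1 h2 h1u))).
rewrite !hornerM !mulf_eq0 !negb_or => /andP[/andP[pc qc] /andP[gc hc]].
have Ou k (a b : 'M[R[i]]_k) : (\det (line k a b)).[c] != 0 ->
    map_mx (horner_eval c) (line k a b) \in unitmx.
  by rewrite unitmxE unitfE det_map_mx.
have OZ := frame_act_orbit (Ou _ _ _ gc) (Ou _ _ _ hc) OX.
rewrite -ZE in OZ.
have [/Ap|/Bq] := sub _ (subset_zariski_closure (ex_intro2 _ _ _ OZ erefl)).
  by rewrite -rpE => /eqP; rewrite (negbTE pc).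
by rewrite -rqE => /eqP; rewrite (negbTE qc).
Qed.

Lemma clear_denominators k (M : 'M[{fraction {poly R[i]}}]_k) :
  (forall i j, laurent (M i j)) ->
  exists2 d : {poly R[i]}, d != 0 &
    exists M' : 'M[{poly R[i]}]_k, map_mx (@tofrac _) M' = tofrac d *: M.
Proof.
move=> lM.
have [p pP] := choice (fun ij : 'I_k * 'I_k => lM ij.1 ij.2).
have [e eP] := choice pP.
pose s := (\sum_ij e ij)%N.
exists 'X^s; first by rewrite -size_poly_eq0 size_polyXn.
exists (\matrix_(i, j) (p (i, j) * 'X^(s - e (i, j)))).
apply/matrixP => i j; rewrite !mxE (eP (i, j)) tofracM mulrCA; congr (_ * _).
have le_es : (e (i, j) <= s)%N.
  by rewrite /s (bigD1 (i, j)) //= leq_addr.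
rewrite -{2}(subnK le_es) exprD tofracM mulfK // tofrac_eq0.
by rewrite -size_poly_eq0 size_polyXn.
Qed.

(** After clearing the denominators of P and Q, the relation between Z, P, Q and
    X holds over the polynomial ring up to a nonzero factor, and it specialises
    at all t where this factor and the two determinants do not vanish. *)
Lemma degenerate_curve X X' : bases_degenerate X X' ->
  exists (d : {poly R[i]}) (Z : m.-tuple 'M[{poly R[i]}]_n),
    [/\ d != 0, X' = map_frame (horner_eval 0) Z &
        forall c, d.[c] != 0 -> exists g h, [/\ g \in unitmx, h \in unitmx &
          map_frame (horner_eval c) Z = frame_act g h X]].
Proof.
move=> [P [Q [[Pu lP _] [Qu lQ _] [Z0 ZP]]]].
have [d d0 [P' P'E]] := clear_denominators lP.
have [e e0 [Q' Q'E]] := clear_denominators lQ.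
pose Z := [tuple Z0 i | i < m].
have detne k (M : 'M[{fraction {poly R[i]}}]_k) M' a :
    M \in unitmx -> a != 0 -> map_mx (@tofrac _) M' = tofrac a *: M ->
    \det M' != 0.
  move=> Mu a0 E; rewrite -tofrac_eq0 -det_map_mx E detZ; apply: mulf_neq0.
    by rewrite expf_neq0 ?tofrac_eq0.
  by rewrite -unitfE -unitmxE; exact: Mu.
have dP := detne _ _ _ _ Pu d0 P'E; have dQ := detne _ _ _ _ Qu e0 Q'E.
(* P enters quadratically, so its denominator d is squared. *)
have [D D0 E] : exists2 D, D != 0 &
    forall i, tnth (frame_act P' Q' (map_frame polyC X)) i = D *: tnth Z i.
  exists (d ^+ 2 * e) => [|i]; first by rewrite mulf_neq0 ?expf_neq0.
  suff EM : map_mx (@tofrac _) (tnth (frame_act P' Q' (map_frame polyC X)) i)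
      = map_mx (@tofrac _) ((d ^+ 2 * e) *: tnth Z i).
    apply/matrixP => a b; move/matrixP/(_ a b): EM.
    by rewrite mxE [RHS]mxE => /eqP; rewrite tofrac_eq => /eqP.
  rewrite [RHS]map_mxZ [tnth Z i]tnth_mktuple -(ZP i).1 -[LHS]tnth_map.
  rewrite -/(map_frame _ _) map_frame_act P'E Q'E frame_actZ.
  rewrite rmorphM rmorphXn; congr (_ *: _); rewrite tnth_mktuple.
  apply: eq_bigr => j _; congr (_ *: (_ *m _ *m _)); rewrite !tnth_map.
  by apply/matrixP => a b; rewrite !mxE.
exists (\det P' * \det Q' * D), Z; split.
- by rewrite !mulf_neq0.
- apply: eq_from_tnth => i; rewrite (ZP i).2 tnth_map tnth_mktuple.
  by apply/matrixP => a b; rewrite !mxE.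
move=> c; rewrite !hornerM !mulf_eq0 !negb_or => /andP[/andP[Pc Qc] Dc].
exists (map_mx (horner_eval c) P'), (D.[c]^-1 *: map_mx (horner_eval c) Q').
split; first by rewrite unitmxE unitfE det_map_mx.
  rewrite unitmxE detZ unitfE mulf_neq0 ?expf_neq0 ?invr_eq0 //.
  by rewrite det_map_mx.
apply: eq_from_tnth => i.
have := frame_actZ (map_mx (horner_eval c) P') (map_mx (horner_eval c) Q') X
  1 D.[c]^-1 i.
rewrite scale1r => ->; rewrite expr1n mul1r.
have := congr1 (map_mx (horner_eval c)) (E i); rewrite -[LHS]tnth_map.
rewrite -/(map_frame _ _) map_frame_act.
rewrite [map_frame _ (map_frame _ _)]map_frame_hornerC => ->.
by rewrite tnth_map map_mxZ scalerA /horner_eval mulVf // scale1r.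
Qed.

(** Any Y in the orbit of L' is the limit of the curve moved by the group element
    that sends X' to Y. *)
Lemma degenerate_orbit_variety L L' X X' : \dim L' = m ->
  orbit_frames L X -> orbit_frames L' X' -> bases_degenerate X X' ->
  orbit_variety m L' `<=` orbit_variety m L.
Proof.
move=> dL' OX OX' /degenerate_curve[d [Z [d0 X'E ZP]]].
apply: zariski_closure_min; first exact: zariski_closure_closed.
move=> _ [Y OY <-]; apply/zariski_closureP => p pO.
have [g [h [gu hu ->]]] := orbit_frames_transitive dL' OX' OY.
pose gZ := frame_act (map_mx polyC g) (map_mx polyC h) Z.
have gZE c : map_frame (horner_eval c) gZ
    = frame_act g h (map_frame (horner_eval c) Z).
  by rewrite map_frame_act !map_mx_hornerC.
have [r rE] := meval_curve p gZ.
rewrite X'E -gZE -rE (_ : r = 0) ?horner0 //.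
apply: (poly_eq0_generic d0) => c /ZP[g' [h' [g'u h'u E]]].
rewrite rE gZE E; apply: pO; eexists; last by [].
by do 2 apply: frame_act_orbit => //.
Qed.

End Degeneration.

(** * Definable sets contain an open part of their closure *)

Section GenericTruth.
Variables (R : realType) (N : nat).
Local Notation K := (R[i]).
Implicit Types (Z : set 'rV[K]_N) (p q : {mpoly K[N]}).

(** Quantifier elimination works with valuations given as sequences; env turns a
    point into a valuation whose entries depend polynomially on the point. *)
Lemma eval_rterm_mpoly (env : 'rV[K]_N -> seq K) (t : GRing.term K) :
  (forall k, exists p, forall x, (env x)`_k = p.@[x ord0]) -> GRing.rterm t ->
  exists p, forall x, GRing.eval (env x) t = p.@[x ord0].
Proof.
move=> envP; elim: t => //=.
- by move=> c _; exists c%:MP => x; rewrite mevalC.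
- by move=> k _; exists (k%:R) => x; rewrite rmorph_nat.
- by move=> t IHt u IHu /andP[/IHt[p pE] /IHu[q qE]]; exists (p + q) => x;
     rewrite mevalD pE qE.
- by move=> t IHt /IHt[p pE]; exists (- p) => x; rewrite mevalN pE.
- by move=> t IHt k /IHt[p pE]; exists (p *+ k) => x; rewrite mevalMn pE.
- by move=> t IHt u IHu /andP[/IHt[p pE] /IHu[q qE]]; exists (p * q) => x;
     rewrite mevalM pE qE.
- by move=> t IHt k /IHt[p pE]; exists (p ^+ k) => x; rewrite rmorphXn pE.
Qed.

(** An equation either holds on all of Z or fails on a nonempty open part of Z;
    Boolean connectives preserve generic constancy, because nonempty open parts
    of an irreducible set meet. *)
Lemma qf_generic_truth Z (env : 'rV[K]_N -> seq K) (f : GRing.formula K) :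
  zariski_irreducible Z ->
  (forall k, exists p, forall x, (env x)`_k = p.@[x ord0]) ->
  GRing.qf_form f -> GRing.rformula f ->
  exists b p, ~ vanishes_on Z p /\
    forall x, Z x -> p.@[x ord0] != 0 -> GRing.qf_eval (env x) f = b.
Proof.
move=> irrZ envP.
have op2 (op : bool -> bool -> bool) f1 f2 :
    (exists b p, ~ vanishes_on Z p /\
      forall x, Z x -> p.@[x ord0] != 0 -> GRing.qf_eval (env x) f1 = b) ->
    (exists b p, ~ vanishes_on Z p /\
      forall x, Z x -> p.@[x ord0] != 0 -> GRing.qf_eval (env x) f2 = b) ->
    exists b p, ~ vanishes_on Z p /\ forall x, Z x -> p.@[x ord0] != 0 ->
      op (GRing.qf_eval (env x) f1) (GRing.qf_eval (env x) f2) = b.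
  move=> [b1 [p1 [n1 h1]]] [b2 [p2 [n2 h2]]]; exists (op b1 b2), (p1 * p2); split.
    by move=> /(irreducible_vanishes_onM irrZ)[].
  move=> x Zx; rewrite mevalM mulf_eq0 negb_or => /andP[p1x p2x].
  by rewrite h1 ?h2.
elim: f => //=.
- move=> b _ _; exists b, 1; split=> //; have [[x Zx] _] := irrZ.
  by apply/vanishes_onPn; exists x; rewrite // meval1 oner_eq0.
- move=> t u _ /andP[rt ru].
  have [p pE] := eval_rterm_mpoly envP rt; have [q qE] := eval_rterm_mpoly envP ru.
  have [Zpq|nZpq] := pselect (vanishes_on Z (p - q)).
    exists true, 1; split; last first.
      by move=> x /Zpq; rewrite mevalB pE qE => /eqP; rewrite subr_eq0.
    have [[x Zx] _] := irrZ.
    by apply/vanishes_onPn; exists x; rewrite // meval1 oner_eq0.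
  exists false, (p - q); split=> // x _.
  by rewrite mevalB subr_eq0 pE qE => /negbTE.
- by move=> f1 I1 f2 I2 /andP[q1 q2] /andP[r1 r2]; apply: (op2 andb); auto.
- by move=> f1 I1 f2 I2 /andP[q1 q2] /andP[r1 r2]; apply: (op2 orb); auto.
- by move=> f1 I1 f2 I2 /andP[q1 q2] /andP[r1 r2]; apply: (op2 implb); auto.
- by move=> f1 I1 q1 r1; apply: (op2 (fun a _ => ~~ a) f1 f1); auto.
Qed.

Definition definable (env : 'rV[K]_N -> seq K) (A : set 'rV[K]_N) :=
  exists2 f : GRing.formula K, GRing.rformula f &
    forall x, A x <-> GRing.holds (env x) f.

(** The generic truth value of a quantifier-free definition of A on the closure
    of A is true, since A is dense there. *)
Lemma definable_generic (env : 'rV[K]_N -> seq K) (A : set 'rV[K]_N) :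
  (forall k, exists p, forall x, (env x)`_k = p.@[x ord0]) ->
  definable env A -> zariski_irreducible (zariski_closure A) ->
  exists2 p, ~ vanishes_on (zariski_closure A) p &
    forall x, zariski_closure A x -> p.@[x ord0] != 0 -> A x.
Proof.
move=> envP [f rf fA] irrA.
pose qe := GRing.quantifier_elim (@ClosedFieldQE.ex_elim K).
have qeP x : reflect (A x) (GRing.qf_eval (env x) (qe f)).
  apply: (iffP (GRing.quantifier_elim_rformP
    (@ClosedFieldQE.wf_ex_elim K)
    (ClosedFieldQE.holds_ex_elim (@solve_monicpoly K)) (env x) rf)).
    by move/fA.
  by move/fA.
have /andP[qqf rqf] : GRing.qf_form (qe f) && GRing.rformula (qe f).
  exact: (GRing.quantifier_elim_wf (@ClosedFieldQE.wf_ex_elim K)).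
have [b [p [np pP]]] := qf_generic_truth irrA envP qqf rqf.
exists p => // x Ax px; apply/qeP; rewrite (pP x Ax px).
(* The nonvanishing locus of p meets A by density, which fixes b = true. *)
have : ~ vanishes_on A p.
  by move=> pA; apply: np => y /zariski_closureP; apply.
move=> /vanishes_onPn[y Ay py].
by rewrite -(pP y (subset_zariski_closure Ay) py); apply/qeP.
Qed.

End GenericTruth.

Section TermFunctions.
Variable F : unitRingType.

(** Functions of a valuation that are denoted by a division-free term.  Closure
    properties replace the writing of explicit terms for matrix products and
    determinants. *)
Definition term_fun (f : seq F -> F) :=
  exists2 t, GRing.rterm t & forall e, GRing.eval e t = f e.

Lemma eq_term_fun f g : (forall e, g e = f e) -> term_fun f -> term_fun g.
Proof. by move=> fg [t rt tE]; exists t => // e; rewrite fg. Qed.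

Lemma term_fun_var k : term_fun (fun e => e`_k).
Proof. by exists (GRing.Var F k). Qed.

Lemma term_fun_const c : term_fun (fun=> c).
Proof. by exists (GRing.Const c). Qed.

Lemma term_funM f g : term_fun f -> term_fun g -> term_fun (fun e => f e * g e).
Proof.
move=> [t rt tE] [u ru uE]; exists (GRing.Mul t u) => [|e] /=; first by rewrite rt.
by rewrite tE uE.
Qed.

Lemma term_fun_sum (I : Type) (r : seq I) (P : pred I) (f : I -> seq F -> F) :
  (forall i, term_fun (f i)) -> term_fun (fun e => \sum_(i <- r | P i) f i e).
Proof.
move=> tf; elim: r => [|i r [t rt tE]].
  by exists (GRing.Const 0) => // e; rewrite big_nil.
have [u ru uE] := tf i; case Pi : (P i); last first.
  by exists t => // e; rewrite big_cons Pi.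
exists (GRing.Add u t) => [|e] /=; first by rewrite ru.
by rewrite big_cons Pi tE uE.
Qed.

Lemma term_fun_prod (I : Type) (r : seq I) (P : pred I) (f : I -> seq F -> F) :
  (forall i, term_fun (f i)) -> term_fun (fun e => \prod_(i <- r | P i) f i e).
Proof.
move=> tf; elim: r => [|i r [t rt tE]].
  by exists (GRing.Const 1) => // e; rewrite big_nil.
have [u ru uE] := tf i; case Pi : (P i); last first.
  by exists t => // e; rewrite big_cons Pi.
exists (GRing.Mul u t) => [|e] /=; first by rewrite ru.
by rewrite big_cons Pi tE uE.
Qed.

Lemma term_fun_det k (A : seq F -> 'M[F]_k) :
  (forall i j, term_fun (fun e => A e i j)) -> term_fun (fun e => \det (A e)).
Proof.
move=> tA; apply: term_fun_sum => s; apply: term_funM.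
  exact: term_fun_const.
by apply: term_fun_prod.
Qed.

End TermFunctions.

(** * The orbit is definable *)

Section OrbitDefinable.
Variables (R : realType) (n m : nat).
Local Notation K := (R[i]).
Local Notation N := (m * (n * n))%N.
Implicit Types (L : {vspace 'M[K]_n}) (X Y : m.-tuple 'M[K]_n).

(** Variables of the formula that defines the orbit: the coordinates of the point,
    then the entries of g and of h, which are quantified. *)
Definition orbit_var : finType := ('I_N + ('I_n * 'I_n + 'I_m * 'I_m))%type.

Definition var_index (a : orbit_var) : nat := enum_rank a.

Definition orbit_valuation (x : 'rV[K]_N) (g : 'M[K]_n) (h : 'M[K]_m)
    (a : orbit_var) : K :=
  match a with
  | inl k => x 0 k
  | inr (inl ij) => g ij.1 ij.2
  | inr (inr ij) => h ij.1 ij.2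
  end.

Definition orbit_env x g h : seq K :=
  [seq orbit_valuation x g h a | a <- enum orbit_var].

Lemma nth_orbit_env x g h a :
  (orbit_env x g h)`_(var_index a) = orbit_valuation x g h a.
Proof.
rewrite (nth_map a) ?nth_enum_rank //.
by rewrite -cardE; exact: ltn_ord.
Qed.

Lemma var_indexP k : (exists a, k = var_index a) \/
  forall x g h, (orbit_env x g h)`_k = 0.
Proof.
have [kV|kV] := ltnP k #|orbit_var|.
  by left; exists (enum_val (Ordinal kV)); rewrite /var_index enum_valK.
by right=> x g h; rewrite nth_default // size_map -cardE.
Qed.

(** With the slots of g and h set to 0, the valuation of a point is polynomial in
    that point; these slots are then overwritten by the quantifiers. *)
Lemma orbit_env_mpoly k :
  exists p, forall x, (orbit_env x 0 0)`_k = p.@[x ord0].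
Proof.
have [[a ->]|env0] := var_indexP k; last by exists 0 => x; rewrite env0 meval0.
case: a => [i|b]; first by exists 'X_i => x; rewrite nth_orbit_env mevalXU.
by exists 0 => x; rewrite nth_orbit_env meval0; case: b => ij /=; rewrite mxE.
Qed.

Definition env_g (e : seq K) : 'M[K]_n :=
  \matrix_(i, j) e`_(var_index (inr (inl (i, j)))).

Definition env_h (e : seq K) : 'M[K]_m :=
  \matrix_(i, j) e`_(var_index (inr (inr (i, j)))).

Lemma term_fun_frame_act X k :
  term_fun (fun e => tuple_coord (frame_act (env_g e) (env_h e) X) ord0 k).
Proof.
case/mxvec_indexP: k => i l; case/mxvec_indexP: l => a b.
apply: (@eq_term_fun _ (fun e => \sum_j e`_(var_index (inr (inr (j, i)))) *
   \sum_l (\sum_k e`_(var_index (inr (inl (a, k)))) * tnth X j k l) *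
          e`_(var_index (inr (inl (b, l)))))).
  move=> e; rewrite /tuple_coord mxvecE mxE mxvecE tnth_mktuple summxE.
  apply: eq_bigr => j _; rewrite !mxE; congr (_ * _).
  apply: eq_bigr => l _; rewrite !mxE; congr (_ * _).
  by apply: eq_bigr => k _; rewrite !mxE.
apply: term_fun_sum => j; apply: term_funM; first exact: term_fun_var.
apply: term_fun_sum => l; apply: term_funM; last exact: term_fun_var.
apply: term_fun_sum => k; apply: term_funM; first exact: term_fun_var.
exact: term_fun_const.
Qed.

Lemma term_fun_units : term_fun (fun e => \det (env_g e) * \det (env_h e)).
Proof.
apply: term_funM; apply: term_fun_det => i j;
  by apply: eq_term_fun (term_fun_var _ _) => e; rewrite mxE.
Qed.

(** The formula says that some g and h with det g * det h nonzero carry the fixed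
    frame X to the point. *)
Lemma orbit_definable L X : \dim L = m -> orbit_frames L X ->
  definable (fun x => orbit_env x 0 0) (@tuple_coord R n m @` orbit_frames L).
Proof.
move=> dL OX.
have [t /all_and2[tr tE]] := choice (fun k =>
  let: ex_intro2 t a b := term_fun_frame_act X k in ex_intro _ t (conj a b)).
have [u ur uE] := term_fun_units.
pose eqn k := GRing.Equal (GRing.Var _ (var_index (inl k))) (t k).
pose eqs := [seq eqn k | k <- enum 'I_N].
pose body := GRing.And (foldr GRing.And (GRing.Bool true) eqs)
  (GRing.Not (GRing.Equal u (GRing.Const 0))).
pose on_orbit e := forall k, e`_(var_index (inl k))
  = tuple_coord (frame_act (env_g e) (env_h e) X) ord0 k.
have bodyP e : GRing.holds e body <-> on_orbit e
    /\ env_g e \in unitmx /\ env_h e \in unitmx.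
  have -> : env_g e \in unitmx /\ env_h e \in unitmx <-> GRing.eval e u <> 0.
    rewrite uE !unitmxE !unitfE; split.
      by move=> [gu hu]; apply/eqP; rewrite mulf_neq0.
    by move=> /eqP; rewrite mulf_eq0 negb_or => /andP[].
  have -> : on_orbit e <->
      GRing.holds e (foldr GRing.And (GRing.Bool true) eqs); last by [].
  have E s : GRing.holds e (foldr GRing.And (GRing.Bool true)
      [seq eqn k | k <- s]) <->
    forall k, k \in s -> e`_(var_index (inl k)) = GRing.eval e (t k).
    elim: s => [|k s IHs] /=; first by split.
    split=> [[ek /IHs es] l|es]; first by rewrite inE => /predU1P[->//|]; exact: es.
    by split; [apply: es; rewrite mem_head
              | apply/IHs => l ls; apply: es; rewrite inE ls orbT].
  rewrite E; split=> h k; first by rewrite tE h.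
  by rewrite h ?mem_enum // tE.
exists (foldr GRing.Exists body
  [seq var_index (inr b) | b <- enum {: 'I_n * 'I_n + 'I_m * 'I_m}]).
  have : GRing.rformula body.
    rewrite /= ur /= andbT /eqs; elim: (enum _) => //= k s ->.
    by rewrite tr.
  by elim: (map _ _).
move=> x; rewrite -GRing.foldExistsP; split.
  move=> [Y OY <-]; have [g [h [gu hu ->]]] := orbit_frames_transitive dL OX OY.
  set y := tuple_coord _.
  have Eg : env_g (orbit_env y g h) = g.
    by apply/matrixP => i j; rewrite mxE nth_orbit_env.
  have Eh : env_h (orbit_env y g h) = h.
    by apply/matrixP => i j; rewrite mxE nth_orbit_env.
  exists (orbit_env y g h).
    move=> k kI; have [[a ka]|env0] := var_indexP k; last by rewrite !env0.
    rewrite ka !nth_orbit_env; case: a ka => // b kb.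
    move: kI; rewrite inE /= kb => /negP[].
    by apply/mapP; exists b; rewrite ?mem_enum.
  apply/bodyP; split; last by rewrite Eg Eh.
  by move=> k; rewrite Eg Eh nth_orbit_env.
move=> [e eE /bodyP[xE [gu hu]]].
exists (frame_act (env_g e) (env_h e) X); first exact: frame_act_orbit.
apply/rowP => k; rewrite -xE -eE ?nth_orbit_env //.
rewrite inE /=; apply/mapP => -[b _ /val_inj/enum_rank_inj].
by [].
Qed.

End OrbitDefinable.

(** * Comparison of the orbit closures *)

Section Congruence.
Variables (R : realType) (n m : nat).
Implicit Types (L : {vspace 'M[R[i]]_n}) (X Y : m.-tuple 'M[R[i]]_n).

(** Chevalley's theorem for the orbit map. *)
Lemma orbit_variety_generic L X : \dim L = m -> orbit_frames L X ->
  exists2 p, ~ vanishes_on (orbit_variety m L) p &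
    forall x, orbit_variety m L x -> p.@[x ord0] != 0 ->
      (@tuple_coord R n m @` orbit_frames L) x.
Proof.
move=> dL OX; apply: (definable_generic (@orbit_env_mpoly R n m)).
  exact: orbit_definable OX.
exact: orbit_variety_irreducible OX.
Qed.

(** The open parts of the two orbits meet in the common irreducible closure. *)
Lemma orbit_variety_congruent L L' X X' : \dim L = m -> \dim L' = m ->
  orbit_frames L X -> orbit_frames L' X' ->
  orbit_variety m L = orbit_variety m L' -> congruent L L'.
Proof.
move=> dL dL' OX OX' E.
have [p np pP] := orbit_variety_generic dL OX.
have [p' np' pP'] := orbit_variety_generic dL' OX'.
rewrite -E in np' pP'.
have : ~ vanishes_on (orbit_variety m L) (p * p').
  by move=> /(irreducible_vanishes_onM (orbit_variety_irreducible dL OX))[].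
move=> /vanishes_onPn[x Lx]; rewrite mevalM mulf_eq0 negb_or => /andP[px p'x].
have [Y [_ LY] YE] := pP x Lx px; have [Y' [_ LY'] YE'] := pP' x Lx p'x.
have YY' : Y = Y' by apply: tuple_coord_inj; rewrite YE.
by apply: congruent_trans LY _; rewrite YY'; exact: congruent_sym.
Qed.

Lemma orbit_dimE L : \dim L = m -> orbit_dim L = variety_dim (orbit_variety m L).
Proof. by move=> <-. Qed.

Lemma degeneratesP L L' : \dim L = m -> degenerates L L' ->
  exists X X' : m.-tuple 'M[R[i]]_n,
    [/\ basis_of L X, basis_of L' X' & bases_degenerate X X'].
Proof. by move=> <-. Qed.

End Congruence.

Theorem proposition6p14 (R : realType) (n m : nat) (L L' : {vspace 'M[R[i]]_n})
    (hL : jordan_space L) (hL' : jordan_space L')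
    (dimL : \dim L = m) (dimL' : \dim L' = m)
    (hdeg : degenerates L L') :
  (orbit_dim L' <= orbit_dim L)%E /\
  (orbit_dim L = orbit_dim L' <-> congruent L L').
Proof.
have [X [X' [bX bX' XX']]] := degeneratesP dimL hdeg.
have OX := basis_orbit_frames hL.1 bX; have OX' := basis_orbit_frames hL'.1 bX'.
have sub := degenerate_orbit_variety dimL' OX OX' XX'.
rewrite (orbit_dimE dimL) (orbit_dimE dimL').
split; first exact: variety_dim_subset.
split=> [eqd|LL']; last by rewrite /orbit_variety (congruent_orbit_frames m LL').
apply: (orbit_variety_congruent dimL dimL' OX OX').
apply/seteqP; split=> //; apply: contrapT => nsub.
have := variety_dim_proper (@zariski_closure_closed _ _ _)
  (orbit_variety_irreducible dimL' OX') (@zariski_closure_closed _ _ _)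
  (orbit_variety_irreducible dimL OX) (conj sub nsub).
by rewrite eqd ltxx.
Qed.
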